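(* For all positive integers $n$ and $k$, we have $$\det_{0\le i,j\le n-1}\left(\mathcal P_{j}(i,k)+t(xy)^{i}\mathcal P_{j}(-i,k)\right)=\begin{cases} (-1)^{kn_1+\binom k2}(1+t)\,t^{k(n_1-1)}(xy)^{k(n_1-1)(2kn_1-k+1)} & \text{if } n=2kn_1-k+1,\\ (-1)^{kn_1}(1+t)\,t^{kn_1-1}(xy)^{kn_1(2kn_1-k-1)} & \text{if } n=2kn_1,\\ 0 & \text{if } n\not\equiv 0,k+1\pmod{2k},\end{cases}$$ where $n_1$ denotes a positive integer, while for $k=0$ we have $$\det_{0\le i,j\le n-1}\left(\mathcal P_{j}(i,0)+t(xy)^{i}\mathcal P_{j}(-i,0)\right)=(1+t)^n(xy)^{\binom n2}.$$
   Context: $x,y,t$ are indeterminates. A three-step path is a lattice path in $\mathbb Z^2$ consisting of steps from $\{(1,0),(1,1),(1,-1)\}$. The steps have weights $w((1,0))=x+y$, $w((1,1))=1$, $w((1,-1))=xy$, and the weight $w(P)$ of a path $P$ is the product of the weights of its steps (the empty path has weight $1$). For integers $n\ge 0$ and $l,k$ (possibly negative), $\mathcal P_n(l,k)=\sum_P w(P)$, where the sum is over all three-step paths $P$ from $(0,l)$ to $(n,k)$ (with no restriction about the $x$-axis). For $k=1$ the first two cases coincide and give the same value. In the matrices, $i$ is the row index and $j$ the column index. *)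

(* Defs.v *)
From HB Require Import structures.
From mathcomp Require Import all_boot all_order all_algebra.

Set Implicit Arguments.
Unset Strict Implicit.
Unset Printing Implicit Defensive.

Import GRing.Theory.
Local Open Scope ring_scope.

Inductive three_step := Level | Up | Down.

Definition option_of_step (s : three_step) : option bool :=
  match s with Level => None | Up => Some true | Down => Some false end.

Definition step_of_option (o : option bool) : three_step :=
  match o with None => Level | Some true => Up | Some false => Down end.

Lemma option_of_stepK : cancel option_of_step step_of_option.
Proof. by case. Qed.

HB.instance Definition _ := Finite.copy three_step (can_type option_of_stepK).

Definition step_vector (s : three_step) : int * int :=
  match s with
  | Level => (1, 0)
  | Up => (1, 1)
  | Down => (1, -1)
  end.

Definition step_weight (R : comNzRingType) (x y : R) (s : three_step) : R :=
  match s with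
  | Level => x + y
  | Up => 1
  | Down => x * y
  end.

(* A path is its starting point together with its sequence of steps. *)
Definition is_path_from_to (A B : int * int) (p : seq three_step) : bool :=
  A + \sum_(s <- p) step_vector s == B.

Definition path_weight (R : comNzRingType) (x y : R) (p : seq three_step) : R :=
  \prod_(s <- p) step_weight x y s.

(* Every step advances the abscissa by 1; this is why the sum defining
   [path_gf n l k] may range over sequences of exactly n steps. *)
Lemma size_path_from_to (n : nat) (l k : int) (p : seq three_step) :
  is_path_from_to (0, l) (n%:Z, k) p -> size p = n.
Proof.
have fst_sum q : (\sum_(s <- q) step_vector s).1 = (size q)%:Z.
  elim: q => [|s q IHq]; first by rewrite big_nil.
  by rewrite big_cons /= IHq; case: s; rewrite /= -intS.
by move/eqP/(congr1 fst); rewrite /= fst_sum add0r => -[].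
Qed.

Definition path_gf (R : comNzRingType) (x y : R) (n : nat) (l k : int) : R :=
  \sum_(p : n.-tuple three_step | is_path_from_to (0, l) (n%:Z, k) p)
     path_weight x y p.

(* Main.v *)
(* Put q = xy and p_j(d) = P_j(0, d), so that P_j(i, k) = p_j(k - i). Since
   p_j(-d) = q^d p_j(d) for d >= 0, the (i, j) entry of the matrix is
   q^(max(i - k, 0)) p_j(|i - k|) + t q^i p_j(i + k). As p_j(d) = 0 for d > j
   and p_j(j) = 1, the matrix is a sparse matrix times the upper unitriangular
   matrix (p_j(d))_(d, j).
   In the sparse matrix of size m + 2k, the last k rows and the last k columns
   each meet the rest in a single diagonal block, so its determinant is an
   explicit monomial (with one factor t replaced by 1 + t when m = 0) times the
   determinant of size m. This reduces everything to n < 2k: for 0 < n <= k the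
   column 0 vanishes, for n = k + 1 the matrix is antidiagonal, and for
   k + 1 < n < 2k the rows k - 1 and k + 1 are proportional. *)
Require Import Defs.
From mathcomp Require Import all_boot all_order all_algebra.
From mathcomp Require Import ring zify.
From mathcomp Require Import mpoly.

Set Implicit Arguments.
Unset Strict Implicit.
Unset Printing Implicit Defensive.

Import GRing.Theory.
Local Open Scope ring_scope.

(** * Path generating functions: recurrences, reflection, vanishing *)

Section PathGF.

Variables (R : comNzRingType) (x y : R).

Lemma big_three_step (F : three_step -> R) :
  \sum_s F s = F Level + F Up + F Down.
Proof.
rewrite (bigD1 Level) // (bigD1 Up) // (bigD1 Down) //= big1 ?addr0 ?addrA //.
by case.
Qed.

Lemma path_gf0 (l k : int) : path_gf x y 0 l k = (l == k)%:R.
Proof.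
rewrite /path_gf big_mkcond (big_pred1 [tuple]) => [|p]; last by apply/esym/eqP/tuple0.
rewrite /is_path_from_to /path_weight !big_nil addr0 xpair_eqE eqxx /=.
by case: eqP.
Qed.

(** Splits off the first step; the remaining path is moved back by one unit to start on the vertical
    axis again. *)
Lemma path_gfS (n : nat) (l k : int) :
  path_gf x y n.+1 l k =
    (x + y) * path_gf x y n l k + path_gf x y n (l + 1) k
    + x * y * path_gf x y n (l - 1) k.
Proof.
have step (s : three_step) :
    \sum_(p : n.-tuple three_step | is_path_from_to (0, l) (n.+1%:Z, k) (s :: p))
       path_weight x y (s :: p)
    = step_weight x y s * path_gf x y n (l + (step_vector s).2) k.
  rewrite /path_gf mulr_sumr; apply: eq_big => [p|p _]; last first.
    by rewrite /path_weight big_cons.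
  rewrite /is_path_from_to big_cons -!pair_eqE /=.
  rewrite !add0r addrA; congr (_ && _).
  by case: s; rewrite /= intS (inj_eq (addrI _)).
pose cns (sp : three_step * n.-tuple three_step) := [tuple of sp.1 :: sp.2].
pose uncns (p : n.+1.-tuple three_step) := (thead p, [tuple of behead p]).
have cnsK : cancel cns uncns.
  by move=> [s p]; congr pair; apply: val_inj.
rewrite {1}/path_gf (reindex_onto cns uncns) /= => [|p _]; last first.
  by rewrite /cns /= -tuple_eta.
transitivity (\sum_(sp : three_step * n.-tuple three_step |
    is_path_from_to (0, l) (n.+1%:Z, k) (sp.1 :: sp.2))
    path_weight x y (sp.1 :: sp.2)).
  by apply: eq_bigl => sp; rewrite cnsK eqxx andbT.
rewrite -(pair_big_dep predT
  (fun s (p : n.-tuple three_step) => is_path_from_to (0, l) (n.+1%:Z, k) (s :: p))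
  (fun s p => path_weight x y (s :: p))) /=.
by rewrite big_three_step !step /= addr0 mul1r.
Qed.

Lemma path_gf_shift (n : nat) (a l k : int) :
  path_gf x y n (l + a) (k + a) = path_gf x y n l k.
Proof.
elim: n l => [|n IHn] l; first by rewrite !path_gf0 (inj_eq (addIr a)).
by rewrite !path_gfS (addrAC l a 1) (addrAC l a (-1)) !IHn.
Qed.

Lemma path_gf_trans (n : nat) (l k : int) :
  path_gf x y n l k = path_gf x y n 0 (k - l).
Proof. by rewrite -(path_gf_shift n l 0) add0r subrK. Qed.

(** By translation invariance, raising the start by 1 amounts to lowering the end by 1. *)
Lemma path_gf_recr (n : nat) (k : int) :
  path_gf x y n.+1 0 k =
    (x + y) * path_gf x y n 0 k + path_gf x y n 0 (k - 1)
    + x * y * path_gf x y n 0 (k + 1).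
Proof.
by rewrite path_gfS (path_gf_trans n (0 + 1)) (path_gf_trans n (0 - 1))
  add0r sub0r opprK.
Qed.

(** Reflecting in the axis exchanges [Up] and [Down]. A path climbing by [d] has [d] more [Up] than
    [Down] steps, so its weight gains [(x * y) ^+ d]. The induction checks this through the
    recurrence. *)
Lemma path_gf_opp (n d : nat) :
  path_gf x y n 0 (- d%:Z) = (x * y) ^+ d * path_gf x y n 0 d%:Z.
Proof.
elim: n d => [|n IHn] [|d]; rewrite ?oppr0 ?mul1r //.
  by rewrite !path_gf0 eq_sym oppr_eq0 eq_sym mulr0.
rewrite !path_gf_recr.
have -> : - d.+1%:Z - 1 = - d.+2%:Z by lia.
have -> : - d.+1%:Z + 1 = - d%:Z by lia.
have -> : d.+1%:Z - 1 = d%:Z by lia.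
have -> : d.+1%:Z + 1 = d.+2%:Z by lia.
by rewrite !IHn !exprS; ring.
Qed.

Lemma path_gf_gt (n d : nat) : (n < d)%N -> path_gf x y n 0 d%:Z = 0.
Proof.
elim: n d => [|n IHn] [|d] // lt_nd; first by rewrite path_gf0.
rewrite path_gf_recr.
have -> : d.+1%:Z - 1 = d%:Z by lia.
have -> : d.+1%:Z + 1 = d.+2%:Z by lia.
by rewrite !IHn ?mulr0 ?addr0 //; lia.
Qed.

Lemma path_gf_diag (n : nat) : path_gf x y n 0 n%:Z = 1.
Proof.
elim: n => [|n IHn]; first by rewrite path_gf0.
rewrite path_gf_recr.
have -> : n.+1%:Z - 1 = n%:Z by lia.
have -> : n.+1%:Z + 1 = n.+2%:Z by lia.
by rewrite IHn !path_gf_gt // !mulr0 addr0 add0r.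
Qed.

End PathGF.

(** * Determinants of matrices given by functions on natural numbers *)

Section NatMatrix.

Variable R : comNzRingType.
Implicit Types f g : nat -> nat -> R.

(** With entries indexed by [nat], blocks and minors are again of this form, with shifted arguments
    and no casts between ordinals. *)
Definition natmx f (n : nat) : 'M[R]_n := \matrix_(i, j) f i j.

Lemma eq_natmx f g (n : nat) :
  (forall i j, (i < n)%N -> (j < n)%N -> f i j = g i j) -> natmx f n = natmx g n.
Proof. by move=> eq_fg; apply/matrixP=> i j; rewrite !mxE eq_fg. Qed.

Lemma natmx_mul f g (n : nat) :
  natmx f n *m natmx g n = natmx (fun i j => \sum_(l < n) f i l * g l j) n.
Proof.
by apply/matrixP=> i j; rewrite !mxE; apply: eq_bigr => l _; rewrite !mxE.
Qed.

Lemma natmx_block f (a b : nat) :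
  natmx f (a + b) =
    block_mx (natmx f a) (\matrix_(i, j) f i (a + j)%N)
             (\matrix_(i, j) f (a + i)%N j)
             (natmx (fun i j => f (a + i)%N (a + j)%N) b).
Proof.
rewrite -[LHS]submxK; congr block_mx; by apply/matrixP=> i j; rewrite !mxE.
Qed.

Lemma det_natmx_ublock f (a b : nat) :
    (forall i j, (i < b)%N -> (j < a)%N -> f (a + i)%N j = 0) ->
  \det (natmx f (a + b)) =
    \det (natmx f a) * \det (natmx (fun i j => f (a + i)%N (a + j)%N) b).
Proof.
move=> f0; rewrite natmx_block.
rewrite (_ : \matrix_(i, j) f (a + i)%N j = 0) ?det_ublock //.
by apply/matrixP=> i j; rewrite !mxE f0.
Qed.

Lemma det_natmx_lblock f (a b : nat) :
    (forall i j, (i < a)%N -> (j < b)%N -> f i (a + j)%N = 0) ->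
  \det (natmx f (a + b)) =
    \det (natmx f a) * \det (natmx (fun i j => f (a + i)%N (a + j)%N) b).
Proof.
move=> f0; rewrite natmx_block.
rewrite (_ : \matrix_(i, j) f i (a + j)%N = 0) ?det_lblock //.
by apply/matrixP=> i j; rewrite !mxE f0.
Qed.

Lemma det_natmx_trig f (n : nat) :
    (forall i j, (j < i < n)%N -> f i j = 0) ->
  \det (natmx f n) = \prod_(i < n) f i i.
Proof.
move=> f0; rewrite -det_tr det_trig.
  by apply: eq_bigr => i _; rewrite !mxE.
by apply/is_trig_mxP => i j lt_ij; rewrite !mxE f0 // lt_ij ltn_ord.
Qed.

(** Expansion along row 0 leaves one term, with an antidiagonal minor; the cofactor signs add up to
    the binomial exponent. *)
Lemma det_natmx_antidiag f (n : nat) :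
    (forall i j, (i <= n)%N -> (j <= n)%N -> (i + j != n)%N -> f i j = 0) ->
  \det (natmx f n.+1) = (-1) ^+ 'C(n.+1, 2) * \prod_(i < n.+1) f i (n - i)%N.
Proof.
elim: n f => [|n IHn] f f0.
  by rewrite det_mx11 big_ord1 bin_small // mul1r mxE.
rewrite (expand_det_row _ ord0) (bigD1 ord_max) //= big1 ?addr0; last first.
  move=> j ne_jn; rewrite mxE f0 ?mul0r //; exact: (ltn_ord j).
rewrite mxE /cofactor.
have -> : row' ord0 (col' ord_max (natmx f n.+2)) = natmx (fun i j => f i.+1 j) n.+1.
  by apply/matrixP=> i j; rewrite !mxE lift_max.
rewrite IHn; last by move=> i j *; apply: f0; lia.
rewrite [in RHS]big_ord_recl subn0 [in RHS]binS bin1 [in RHS]exprD /=.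
under [in RHS]eq_bigr => i _ do rewrite /bump add1n subSS.
rewrite add0n; ring.
Qed.

(** On indices below [m + k + k], this is the involution exchanging the two blocks of length [k]
    that follow the first [m] indices. *)
Definition block_swap (m k j : nat) : nat :=
  if (j < m)%N then j else if (j < m + k)%N then (j + k)%N else (j - k)%N.

Lemma det_swap_mx (k : nat) :
  \det (block_mx 0 1%:M 1%:M 0 : 'M[R]_(k + k)) = (-1) ^+ k.
Proof.
(* Two block row operations of determinant 1 make the matrix block triangular. *)
have ops : block_mx 1%:M 0 (- 1%:M) 1%:M *m
    (block_mx 1%:M 1%:M 0 1%:M *m block_mx 0 1%:M 1%:M 0 : 'M[R]_(k + k))
    = block_mx 1%:M 1%:M 0 (- 1%:M).
  by rewrite !mulmx_block !(mul1mx, mulmx1, mul0mx, mulmx0, add0r, addr0,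
    mulNmx, addNr).
move/(congr1 determinant): ops.
rewrite !det_mulmx det_lblock !det_ublock !det1 !mul1r => ->.
by rewrite -scaleN1r detZ det1 mulr1.
Qed.

Lemma det_natmx_swap f (m k : nat) :
  \det (natmx (fun i j => f i (block_swap m k j)) (m + k + k)) =
    (-1) ^+ k * \det (natmx f (m + k + k)).
Proof.
(* The permutation matrix of the swap: an identity block of size [m] followed by the matrix of
   [det_swap_mx]. *)
pose s l j : R := (l == block_swap m k j)%:R.
have -> : natmx (fun i j => f i (block_swap m k j)) (m + k + k) =
    natmx f (m + k + k) *m natmx s (m + k + k).
  rewrite natmx_mul; apply: eq_natmx => i j _ lt_j.
  have lt_sj : (block_swap m k j < m + k + k)%N by rewrite /block_swap; do 2?case: ifP; lia.
  rewrite (bigD1 (Ordinal lt_sj)) //= /s eqxx mulr1 big1 ?addr0 // => l ne_l.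
  by rewrite (negbTE (ne_l : val l != _)) mulr0.
rewrite det_mulmx mulrC; congr (_ * _).
rewrite -addnA det_natmx_ublock => [|i j ltib ltja]; last first.
  by rewrite /s /block_swap ltja; case: eqP => //; lia.
rewrite (@eq_natmx _ (fun i j => (i == j)%:R)) => [|i j _ ltjm]; last first.
  by rewrite /s /block_swap ltjm.
rewrite det_natmx_trig => [|i j /andP[ltji _]]; last by rewrite gtn_eqF.
rewrite big1 ?mul1r => [|i _]; last by rewrite eqxx.
rewrite -det_swap_mx natmx_block; congr (\det (block_mx _ _ _ _));
  apply/matrixP=> i j; have := ltn_ord i; have := ltn_ord j;
  rewrite !mxE /s /block_swap => ltj lti.
- by do ?case: ifP; case: eqP => //; lia.
- by congr (_%:R); rewrite -(inj_eq val_inj) /=; do ?case: ifP; lia.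
- by congr (_%:R); rewrite -(inj_eq val_inj) /=; do ?case: ifP; lia.
- by do ?case: ifP; case: eqP => //; lia.
Qed.

End NatMatrix.

(** * The sparse matrix and its determinant *)

Section FoldedMatrix.

Variables (R : comNzRingType) (q t : R) (k : nat).

(* Entry (i, j) is [j = |i - k|] q^(max(i - k, 0)) + [j = i + k] t q^i;
   truncated subtraction encodes both the absolute value and the maximum. *)
Definition fold_entry (i j : nat) : R :=
  (j == (i - k) + (k - i))%N%:R * q ^+ (i - k) + (j == i + k)%N%:R * t * q ^+ i.

Definition fold_det (n : nat) : R := \det (natmx fold_entry n).

Lemma fold_entry0 (i j : nat) :
  j <> (i - k + (k - i))%N -> j <> (i + k)%N -> fold_entry i j = 0.
Proof. by rewrite /fold_entry; do 2!case: eqP => //; rewrite !mul0r addr0. Qed.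

Hypothesis k_gt0 : (0 < k)%N.

(** The two positions [|i - k|] and [i + k] coincide only in row 0; this is the source of the factor
    [1 + t]. *)
Lemma fold_entry_up (i : nat) :
  fold_entry i (i + k) = ((i == 0)%N%:R + t) * q ^+ i.
Proof.
rewrite /fold_entry eqxx mul1r mulrDl; congr (_ + _).
case: i => [|i]; first by rewrite !sub0n subn0 add0n eqxx.
by rewrite mul0r; case: eqP; rewrite ?mul0r //; lia.
Qed.

Lemma fold_entry_down (i : nat) : fold_entry (i + k) i = q ^+ i.
Proof.
rewrite /fold_entry addnK; case: (i =P (i + k + k)%N) => [|_]; first by lia.
by rewrite !mul0r addr0; case: eqP; rewrite ?mul1r //; lia.
Qed.

(** Once the last two column blocks are exchanged, the last [k] rows vanish outside the last block,
    and the first [m] rows vanish on the middle one. The determinant is then the product of the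
    three diagonal blocks, the last two of which are diagonal matrices. *)
Lemma fold_detD (m : nat) :
  fold_det (m + k + k) =
    (-1) ^+ k * (\prod_(r < k) ((m + r == 0)%N%:R + t))
    * q ^+ (k * (2 * m + k - 1)) * fold_det m.
Proof.
(* Multiplying both sides by the sign lets the left side absorb it as a column swap. *)
apply: (inv_inj (signrMK k)).
rewrite -!mulrA signrMK -(det_natmx_swap fold_entry).
rewrite det_natmx_ublock => [|i j lti ltj]; last first.
  by rewrite /block_swap fold_entry0 //; do ?case: ifP; lia.
rewrite det_natmx_lblock => [|i j lti ltj]; last first.
  by rewrite /block_swap fold_entry0 //; do ?case: ifP; lia.
rewrite [X in X * _ * _](_ : _ = fold_det m); last first.
  by congr (\det _); apply: eq_natmx => i j _ ltj; rewrite /block_swap ltj.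
rewrite [X in _ * X * _](_ : _ =
    \prod_(r < k) (((m + r == 0)%N%:R + t) * q ^+ (m + r))); last first.
  rewrite (@eq_natmx _ _ (fun i j => fold_entry (m + i) (m + j + k))).
    rewrite det_natmx_trig => [|i j ltji]; last by rewrite fold_entry0 //; lia.
    by apply: eq_bigr => r _; rewrite fold_entry_up.
  by move=> i j _ ltj; rewrite /block_swap ltnNge leq_addr ltn_add2l ltj.
rewrite [X in _ * X = _](_ : _ = \prod_(r < k) q ^+ (m + r)); last first.
  rewrite (@eq_natmx _ _ (fun i j => fold_entry (m + i + k) (m + j))).
    rewrite det_natmx_trig => [|i j ltji]; last by rewrite fold_entry0 //; lia.
    by apply: eq_bigr => r _; rewrite fold_entry_down.
  move=> i j _ ltj; rewrite /block_swap (addnAC m k i) (addnAC m k j) addnK.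
  by do 2![case: ifP => [|_]; first by lia].
(* Each of the two diagonal blocks contributes the same power of [q]. *)
have sumE : (\sum_(r < k) (m + r) + \sum_(r < k) (m + r) = k * (2 * m + k - 1))%N.
  elim: (k) => [|j IHj]; first by rewrite !big_ord0.
  rewrite !big_ord_recr /= addnACA IHj; case: (j) => [|j']; nia.
rewrite big_split /= !prodrXr -sumE exprD.
by ring.
Qed.

Lemma fold_detD_pos (m : nat) : (0 < m)%N ->
  fold_det (m + k + k) =
    (-1) ^+ k * t ^+ k * q ^+ (k * (2 * m + k - 1)) * fold_det m.
Proof.
move=> m_gt0; rewrite fold_detD; congr (_ * _ * _ * _).
rewrite (eq_bigr (fun=> t)) ?prodr_const ?card_ord // => r _.
by rewrite addn_eq0 eqn0Ngt m_gt0 add0r.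
Qed.

Lemma fold_det0 : fold_det 0 = 1.
Proof. exact: det_mx00. Qed.

Lemma fold_det2k :
  fold_det (k + k) = (-1) ^+ k * ((1 + t) * t ^+ (k - 1)) * q ^+ (k * (k - 1)).
Proof.
rewrite -{1}[k]add0n fold_detD fold_det0 mulr1 muln0 add0n.
congr (_ * _ * _); case: k k_gt0 => // j _.
rewrite big_ord_recl /= subn1 /=; congr (_ * _).
by rewrite (eq_bigr (fun=> t)) ?prodr_const ?card_ord // => r _; rewrite add0r.
Qed.

Lemma fold_detSk : fold_det k.+1 = (-1) ^+ (k + 'C(k, 2)) * (1 + t).
Proof.
rewrite /fold_det det_natmx_antidiag => [|i j lei lej ne_ij]; last first.
  by rewrite fold_entry0 //; lia.
rewrite binS bin1 addnC; congr (_ * _).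
rewrite big_ord_recl subn0 fold_entry_up mulr1 big1 ?mulr1 // => i _.
rewrite /fold_entry lift0; have lti := ltn_ord i.
rewrite (_ : (i.+1 - k)%N = 0%N) ?add0n ?eqxx ?mulr1; last by lia.
by case: eqP => [|_]; rewrite ?mul0r ?addr0 //; lia.
Qed.

Lemma fold_det_small (n : nat) :
  (0 < n < k + k)%N -> n <> k.+1 -> fold_det n = 0.
Proof.
move=> /andP[n_gt0 ltn2k] neqn; have [le_nk|lt_kn] := leqP n k.
  (* Column 0 could be nonzero only in row [k], which is absent here. *)
  rewrite /fold_det (expand_det_col _ (Ordinal n_gt0)) big1 // => i _.
  by rewrite mxE fold_entry0 ?mul0r //=; have := ltn_ord i; lia.
have lt1 : (k - 1 < n)%N by lia.
have lt2 : (k + 1 < n)%N by lia.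
(* Row k + 1 is q times row k - 1: their only nonzero entry is in column 1. *)
rewrite /fold_det; set A := natmx fold_entry n; pose i1 := Ordinal lt1; pose i2 := Ordinal lt2.
have rowE j : A i2 j = q * A i1 j.
  have ltj := ltn_ord j; rewrite !mxE /=.
  have [->|ne_j1] := eqVneq (j : nat) 1%N; last by rewrite !fold_entry0 ?mulr0 //; lia.
  rewrite addnC fold_entry_down expr1 /fold_entry.
  have -> : (k - 1 - k)%N = 0%N by lia.
  have -> : (k - (k - 1))%N = 1%N by lia.
  rewrite add0n eqxx mulr1.
  by case: eqP => [|_]; rewrite ?mul0r ?addr0 ?mulr1 //; lia.
(* In [A *m \adj A], the diagonal entry at [i2] is the determinant; by proportionality it is also
   [q] times the off-diagonal entry at [(i1, i2)], which is 0. *)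
have := mul_mx_adj A => /matrixP adjA.
have := adjA i2 i2; rewrite !mxE eqxx mulr1n => <-.
under eq_bigr => j _ do rewrite rowE -mulrA.
rewrite -mulr_sumr; have := adjA i1 i2; rewrite !mxE => ->.
by rewrite -(inj_eq val_inj) /= (_ : (k - 1 == k + 1)%N = false) ?mulr0 //; lia.
Qed.

Lemma fold_det_block (s m : nat) :
  (0 < m)%N -> fold_det m = 0 -> fold_det (2 * k * s + m) = 0.
Proof.
move=> m_gt0 Dm0; elim: s => [|s IHs]; first by rewrite muln0.
have -> : (2 * k * s.+1 + m = 2 * k * s + m + k + k)%N by nia.
by rewrite fold_detD_pos ?IHs ?mulr0 //; lia.
Qed.

Lemma fold_det_eq0 (n : nat) :
  n <> 0 %[mod 2 * k] -> n <> k + 1 %[mod 2 * k] -> fold_det n = 0.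
Proof.
move=> n_ne0 n_nek; rewrite (divn_eq n (2 * k)) mulnC.
have lt_mod : (n %% (2 * k) < 2 * k)%N by rewrite ltn_mod; lia.
move: n_ne0; rewrite mod0n => n_ne0.
apply: fold_det_block; first by lia.
apply: fold_det_small => [|mod_n]; first by lia.
by apply: n_nek; rewrite addn1 -mod_n modn_mod.
Qed.

(** Here [s] is [n1 - 1]. The base case of size [k.+1] supplies [1 + t] and the binomial sign; every
    later extension has [m > 0] and contributes only powers of -1, [t] and [q]. *)
Lemma fold_det_succ_multiple (s : nat) :
  fold_det (2 * k * s + k.+1) =
    (-1) ^+ (k * s.+1 + 'C(k, 2)) * (1 + t) * t ^+ (k * s)
    * q ^+ (k * s * (2 * k * s + k.+1)).
Proof.
elim: s => [|s IHs].
  by rewrite muln0 add0n fold_detSk muln1 !muln0 !mulr1.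
have -> : (2 * k * s.+1 + k.+1 = 2 * k * s + k.+1 + k + k)%N by nia.
rewrite fold_detD_pos ?IHs ?addnS //.
have -> : (k * s.+1 * (2 * k * s + k + k + k).+1 =
    k * (2 * (2 * k * s + k).+1 + k - 1) + k * s * (2 * k * s + k).+1)%N by nia.
have -> : (k * s.+2 + 'C(k, 2) = k + (k * s.+1 + 'C(k, 2)))%N by nia.
have -> : (k * s.+1 = k + k * s)%N by nia.
by rewrite !exprD; ring.
Qed.

(** The induction starts at size [2 * k], not 0: extending the empty matrix is the one step that
    yields [1 + t]. *)
Lemma fold_det_multiple (s : nat) :
  fold_det (2 * k * s.+1) =
    (-1) ^+ (k * s.+1) * (1 + t) * t ^+ (k * s.+1 - 1)
    * q ^+ (k * s.+1 * (2 * k * s.+1 - k - 1)).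
Proof.
elim: s => [|s IHs].
  rewrite !muln1 mul2n -addnn fold_det2k addnK.
  by ring.
have -> : (2 * k * s.+2 = 2 * k * s.+1 + k + k)%N by nia.
rewrite fold_detD_pos ?IHs; last by nia.
have -> : (k * s.+2 * (2 * k * s.+1 + k + k - k - 1) =
    k * (2 * (2 * k * s.+1) + k - 1) + k * s.+1 * (2 * k * s.+1 - k - 1))%N.
  by case: k k_gt0 => // j _; nia.
have -> : (k * s.+2 - 1 = k + (k * s.+1 - 1))%N by nia.
have -> : (k * s.+2 = k + k * s.+1)%N by nia.
by rewrite !exprD; ring.
Qed.

End FoldedMatrix.

(** * The case of [k = 0], and the passage from path sums to the sparse matrix *)

Lemma fold_det_k0 (R : comNzRingType) (q t : R) (n : nat) :
  fold_det q t 0 n = (1 + t) ^+ n * q ^+ 'C(n, 2).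
Proof.
rewrite /fold_det det_natmx_trig => [|i j /andP[ltji _]].
  rewrite (eq_bigr (fun i : 'I_n => (1 + t) * q ^+ i)) => [|i _].
    by rewrite big_split /= prodr_const card_ord prodrXr -bin2_sum big_mkord.
  by rewrite /fold_entry subn0 sub0n !addn0 eqxx mulrDl !mul1r.
by rewrite fold_entry0 //; lia.
Qed.

Lemma det_path_gf (R : comNzRingType) (x y t : R) (k n : nat) :
  \det (\matrix_(i < n, j < n)
          (path_gf x y j i%:Z k%:Z
           + t * (x * y) ^+ i * path_gf x y j (- i%:Z) k%:Z))
  = fold_det (x * y) t k n.
Proof.
pose p j d := path_gf x y j 0 d%:Z.
have detU : \det (natmx (fun d j => p j d) n) = 1.
  rewrite det_natmx_trig => [|d j /andP[ltjd _]]; last exact: path_gf_gt.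
  by rewrite big1 // => j _; apply: path_gf_diag.
rewrite -[RHS]mulr1 -detU -det_mulmx; congr (\det _).
apply/matrixP=> i j; rewrite natmx_mul !mxE.
(* The indicator selects [d = a]. An [a] beyond the range of the sum costs nothing, since then
   [j < n <= a] and [p j a = 0]. *)
have delta (a : nat) (c : R) :
    \sum_(d < n) (d == a :> nat)%:R * c * p j d = c * p j a.
  have [lt_an|le_na] := ltnP a n.
    rewrite (bigD1 (Ordinal lt_an)) //= eqxx mul1r big1 ?addr0 // => d ne_d.
    by rewrite (negbTE (ne_d : val d != a)) !mul0r.
  rewrite [p j a]path_gf_gt ?mulr0; last exact: leq_trans (ltn_ord j) le_na.
  by rewrite big1 // => d _; rewrite ltn_eqF ?mul0r ?(leq_trans (ltn_ord d)).
under [RHS]eq_bigr => d _ do rewrite /fold_entry mulrDl -(mulrA _ t).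
rewrite big_split /= !delta (path_gf_trans _ _ _ i) (path_gf_trans _ _ _ (- i%:Z)).
congr (_ + _); last first.
  by rewrite /p; congr (_ * path_gf _ _ _ _ _); lia.
(* For [i > k] the height difference [k - i] is negative, and reflection produces the factor
   [q ^+ (i - k)]. *)
have [le_ik|lt_ki] := leqP i k.
  rewrite (_ : (i - k = 0)%N) ?mul1r /p; last by lia.
  by congr (path_gf _ _ _ _ _); lia.
rewrite (_ : (k - i = 0)%N) ?addn0 /p -?path_gf_opp; last by lia.
by congr (path_gf _ _ _ _ _); lia.
Qed.

Theorem theorem10 (n : nat) (hn : (0 < n)%N) :
  let x : {mpoly int[3]} := 'X_(@Ordinal 3 0 isT) in
  let y : {mpoly int[3]} := 'X_(@Ordinal 3 1 isT) in
  let t : {mpoly int[3]} := 'X_(@Ordinal 3 2 isT) in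
  let D (k : nat) : {mpoly int[3]} :=
    \det (\matrix_(i < n, j < n)
            (path_gf x y j i%:Z k%:Z
             + t * (x * y) ^+ i * path_gf x y j (- i%:Z) k%:Z)) in
  (forall k : nat, (0 < k)%N ->
     [/\ forall n1 : nat, (0 < n1)%N -> n = (2 * k * n1 - k + 1)%N ->
           D k = (-1) ^+ (k * n1 + 'C(k, 2)) * (1 + t) * t ^+ (k * (n1 - 1))
                 * (x * y) ^+ (k * (n1 - 1) * (2 * k * n1 - k + 1)),
         forall n1 : nat, (0 < n1)%N -> n = (2 * k * n1)%N ->
           D k = (-1) ^+ (k * n1) * (1 + t) * t ^+ (k * n1 - 1)
                 * (x * y) ^+ (k * n1 * (2 * k * n1 - k - 1))
       & n <> 0 %[mod 2 * k] -> n <> k + 1 %[mod 2 * k] -> D k = 0])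
  /\ D 0%N = (1 + t) ^+ n * (x * y) ^+ 'C(n, 2).
Proof.
move=> x y t D.
have DE k : D k = fold_det (x * y) t k n by apply: det_path_gf.
split=> [k k_gt0|]; last by rewrite DE fold_det_k0.
rewrite DE; split=> [[//|s] _ nE|[//|s] _ nE|]; last exact: fold_det_eq0.
  have <- : (2 * k * s + k.+1 = 2 * k * s.+1 - k + 1)%N by nia.
  rewrite subn1 -fold_det_succ_multiple //; congr fold_det; nia.
by rewrite nE fold_det_multiple.
Qed.
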